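(* Sierksma's conjecture on the number of Tverberg partitions holds for $q=3$ and $d=2$: every set $X$ of $7$ points in $\mathbb{R}^2$ has at least $((3-1)!)^2=4$ Tverberg partitions into $3$ subsets.
   Context: For a set $X$ of $(d+1)(q-1)+1$ points in $\mathbb{R}^d$, a Tverberg partition of $X$ is an (unordered) partition of $X$ into $q$ non-empty subsets whose convex hulls have a non-empty common intersection. Sierksma's conjecture states that the number of Tverberg partitions of any such $X$ is at least $((q-1)!)^d$. *)

(* Defs.v *)
From mathcomp Require Import all_boot all_order all_algebra finmap.
From mathcomp Require Import all_classical all_reals convex.

Set Implicit Arguments.
Unset Strict Implicit.
Unset Printing Implicit Defensive.

Local Open Scope classical_set_scope.

Definition convex_hull (R : realType) (d : nat) (A : set 'rV[R]_d) :
    set 'rV[R]_d :=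
  smallest (@convex_set R 'rV[R]_d) A.

(* The finite set X is used as a finite type, whose elements are sent to points
   by val, so that blocks have type {set X}. The predicate
   finset.partition requires non-empty blocks. *)
Definition tverberg_partition (R : realType) (d q : nat)
    (X : {fset 'rV[R]_d}) (P : {set {set X}}) : Prop :=
  [/\ finset.partition P [set: X]%SET,
      #|P| = q
    & \bigcap_(B in [set` P]) convex_hull (val @` [set` B]) !=set0].

Definition tverberg_partitions (R : realType) (d q : nat)
    (X : {fset 'rV[R]_d}) : {set {set {set X}}} :=
  [set P : {set {set X}} | `[< tverberg_partition q P >]]%SET.

(* Main.v *)
Require Import Defs.
From mathcomp Require Import all_boot all_order all_algebra finmap.
From mathcomp Require Import all_classical all_reals convex.
From mathcomp Require Import interval_inference topology normedtype derive.
From mathcomp Require Import zify ring lra.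

(** Seven points in general position are treated first. Take a vertex 0 of their
    convex hull and number the other points 1, ..., 6 by angle around it. All
    triples containing 0 are then positively oriented, and the three-term
    Grassmann-Plucker relations through 0 make the orientations of the triples of
    {1, ..., 6} monotone on every quadruple ([quad_monotone]); only 908 sign
    patterns obey this.

    A Tverberg partition in general position has block sizes 1 + 3 + 3, a point in
    two triangles, or 2 + 2 + 3, the crossing point z of two segments ab and cd in
    a triangle efg. The sign pattern decides the first kind. It decides only
    whether ab and cd cross, but not always whether z lies in efg: the order type
    of seven points does not determine the number of Tverberg partitions. The side
    of z with respect to the line ef is the sign of [concur], the determinant of
    the three lines ab, cd, ef. Up to a sign known from the pattern it also gives
    the position of the crossing of ab and ef with respect to cd, and of the
    crossing of cd and ef with respect to ab, so that the crossings are not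
    independent of each other. Moreover z has to be compatible with the seven
    points: if a and b are on the same side of ef then so is z, and the
    Grassmann-Plucker relations with pivot e, f or g hold ([corner_between]). These
    constraints suffice. For each of the 908 patterns, branching on the signs of
    the determinants [concur] and discarding the branches that violate a
    constraint leaves only branches with at least four partitions. This finite
    search is run by the kernel ([explore_all]) and its meaning is given by
    [check_sound].

    An arbitrary configuration is moved into general position by adding a small
    multiple of seven points of the moment curve ([generic_shift]). Being a
    Tverberg partition is a closed condition, because the coefficients of the
    convex combinations range over a compact set ([meeting_closed]). As there are
    only finitely many partitions of the seven points, every Tverberg partition of
    a sufficiently small perturbation is one of the original configuration. *)

Set Implicit Arguments.
Unset Strict Implicit.
Unset Printing Implicit Defensive.

Import Order.TTheory GRing.Theory Num.Theory.
Import numFieldNormedType.Exports.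

(** * Splittings of seven labels and the search *)

Fixpoint selections (k : nat) (s : seq nat) : seq (seq nat * seq nat) :=
  match k, s with
  | 0, _ => [:: ([::], s)]
  | _, [::] => [::]
  | k'.+1, x :: s' => [seq (x :: AB.1, AB.2) | AB <- selections k' s']
                     ++ [seq (AB.1, x :: AB.2) | AB <- selections k s']
  end.

(** The head of [s] always goes to the first half, so that each unordered pair of
    halves is listed once. *)
Definition halvings (s : seq nat) : seq (seq nat * seq nat) :=
  if s is x :: s' then
    [seq (x :: AB.1, AB.2) | AB <- selections (size s)./2.-1 s']
  else [::].

Definition splittings (k : nat) : seq (seq (seq nat)) :=
  [seq [:: TU.1; AB.1; AB.2] | TU <- selections k (iota 0 7),
                               AB <- halvings TU.2].

Definition stars := splittings 1.
Definition crossings := splittings 3.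

(** The triples that avoid the hull vertex 0, in colexicographic order. *)
Definition triples : seq (nat * nat * nat) :=
  [seq t | k <- iota 1 6,
           t <- [seq (i, j, k) | j <- iota 1 k.-1, i <- iota 1 j.-1]].

Definition triple_index i j k := index (i, j, k) triples.

(** For i < j < k < l, the positions of ijk, ijl, ikl, jkl in [triples]; the order
    of [triples] puts jkl last. *)
Definition quads : seq (nat * nat * nat * nat) :=
  [seq (triple_index t.1.1 t.1.2 t.2, triple_index t.1.1 t.1.2 l,
        triple_index t.1.1 t.2 l, triple_index t.1.2 t.2 l)
     | l <- iota 1 6, t <- [seq t <- triples | t.2 < l]].

Definition alternates (b1 b2 b3 : bool) := (b1 != b2) && (b2 != b3).

(** At most one sign change: the axiom of a signotope of rank three, that is of a
    pseudoline arrangement. *)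
Definition monotone (b1 b2 b3 b4 : bool) :=
  ~~ [|| alternates b1 b2 b3, alternates b1 b2 b4,
         alternates b1 b3 b4 | alternates b2 b3 b4].

Definition monotone_quad (l : seq bool) (q : nat * nat * nat * nat) :=
  let: (q1, q2, q3, q4) := q in
  monotone (nth true l q1) (nth true l q2) (nth true l q3) (nth true l q4).

Definition increasing_sign (l : seq bool) i j k :=
  if i == 0 then true else nth true l (triple_index i j k).

Definition alternate (f : nat -> nat -> nat -> bool) (a b c : nat) : bool :=
  if a < b then
    if b < c then f a b c else if a < c then ~~ f a c b else f c a b
  else
    if a < c then ~~ f b a c else if b < c then f b c a else ~~ f c b a.

(** The search reads orientations many thousand times; a table makes this cheap. *)
Definition tabulate (f : nat -> nat -> nat -> bool) : seq (seq (seq bool)) :=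
  mkseq (fun a => mkseq (fun b => mkseq (f a b) 7) 7) 7.

Definition entry (t : seq (seq (seq bool))) a b c :=
  nth true (nth [::] (nth [::] t a) b) c.

(** A literal fixes the sign of the determinant of three lines, which are listed
    by pairs of points in lexicographic order. *)
Definition literal := (seq nat * bool)%type.

(** A conceivable position of a crossing point with respect to the lines of its
    triangle, with the information whether the point is then in the triangle. *)
Definition position := (seq literal * bool)%type.

Section Check.
Variable s : nat -> nat -> nat -> bool.

Definition in_triangle p a b c :=
  (s a b p == s b c p) && (s b c p == s c a p).

Definition star_ok (B : seq (seq nat)) :=
  if B is [:: [:: p]; [:: a; b; c]; [:: d; e; f]] then
    in_triangle p a b c && in_triangle p d e f
  else false.

Definition segments_cross a b c d :=
  (s a b c != s a b d) && (s c d a != s c d b).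

(** Here and below z is the crossing point of ab and cd, and u and v are the
    orientations of x, y, z and of x, w, z. The constraint holds because z lies
    between a and b and between c and d. *)
Definition edge_consistent a b c d x y (u : bool) :=
  ((s x y a == s x y b) ==> (u == s x y a)) &&
  ((s x y c == s x y d) ==> (u == s x y c)).

(** If z = q + t (o - q), the Grassmann-Plucker relation with pivot x is
    orient x y z * orient x w q = orient x w z * orient x y q
                                  + t * orient x o q * orient x y w.
    As t > 0, the signs of its terms exclude one pattern and its opposite. *)
Definition corner_consistent1 q o x y w (u v : bool) :=
  let t := (v == s x y q) in
  ~~ (((u != s x w q) == t) && (t == (s x o q == s x y w))).

Definition corner_consistent a b c d x y w (u v : bool) :=
  [&& corner_consistent1 a b x y w u v, corner_consistent1 b a x y w u v,
      corner_consistent1 c d x y w u v & corner_consistent1 d c x y w u v].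

(** [o] holds the orientations of efz, fgz and gez. *)
Definition consistent_position a b c d e f g (o : bool * bool * bool) :=
  let: (u, v, w) := o in
  [&& edge_consistent a b c d e f u, edge_consistent a b c d f g v,
      edge_consistent a b c d g e w,
      corner_consistent a b c d e f g u (~~ w),
      corner_consistent a b c d f g e v (~~ u) &
      corner_consistent a b c d g e f w (~~ v)].

Definition sign_triples : seq (bool * bool * bool) :=
  [seq (uv, w) | uv <- [seq (u, v) | u <- [:: true; false],
                                     v <- [:: true; false]],
                 w <- [:: true; false]].

(** Sorting the lines lets the three crossing points of three lines share one
    literal; the boolean tells whether the sorting permutation is even. In the
    listed crossings a < c. *)
Definition sorted_lines a b c d x y : literal :=
  if x < a then ([:: x; y; a; b; c; d], true)
  else if x < c then ([:: a; b; x; y; c; d], false)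
  else ([:: a; b; c; d; x; y], true).

(** The orientation of x, y, z is the sign of the determinant of the lines ab, cd,
    xy times the orientation of a, c, d. *)
Definition side_literal a b c d x y (u : bool) : literal :=
  let: (k, even) := sorted_lines a b c d x y in (k, u == (s a c d == even)).

Definition position_literals a b c d e f g (o : bool * bool * bool) :=
  let: (u, v, w) := o in
  [:: side_literal a b c d e f u; side_literal a b c d f g v;
      side_literal a b c d e g (~~ w)].

Definition positions (B : seq (seq nat)) : seq position :=
  if B is [:: [:: e; f; g]; [:: a; b]; [:: c; d]] then
    let o := s e f g in
    [seq (position_literals a b c d e f g x, x == (o, o, o))
       | x <- sign_triples & consistent_position a b c d e f g x]
  else [::].

Definition may_meet B :=
  if B is [:: [:: e; f; g]; [:: a; b]; [:: c; d]] then
    segments_cross a b c d &&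
    let o := s e f g in consistent_position a b c d e f g (o, o, o)
  else false.

Definition compatible (asg : seq literal) (l : literal) :=
  all (fun m => (m.1 == l.1) ==> (m.2 == l.2)) asg.

(** Every way to choose one position for each crossing point without contradicting
    [asg] or an earlier choice makes the count [n] of partitions reach four.
    Conditionals replace boolean connectives because evaluation by value would
    compute both sides of a connective, hence also the pruned branches. *)
Fixpoint search (n : nat) (asg : seq literal) (ts : seq (seq position)) : bool :=
  if 4 <= n then true else
  if ts is t :: ts' then
    all (fun c : position =>
      if all (compatible asg) c.1 then search (n + c.2) (c.1 ++ asg) ts'
      else true) t
  else false.

Definition check :=
  search (count star_ok stars) [::]
         [seq positions B | B <- crossings & may_meet B].
End Check.

(** Extends a prefix [l] of a sign pattern by [n] signs in all ways that are
    monotone on the quadruples completed so far, and checks each full pattern. *)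
Fixpoint explore (n : nat) (l : seq bool) : bool :=
  if n is m.+1 then
    all (fun b => let l' := rcons l b in
      if all (fun q => (q.2.+1 == size l') ==> monotone_quad l' q) quads
      then explore m l' else true) [:: true; false]
  else let t := tabulate (alternate (increasing_sign l)) in check (entry t).

Lemma explore_all : explore 20 [::].
Proof. by vm_compute. Qed.

(** [sigma] stands for the signs of an actual configuration: whatever they are,
    the search has followed the branch that agrees with them. *)
Lemma search_sound (sigma : seq nat -> bool) ts n asg :
  let agrees := all (fun l : literal => sigma l.1 == l.2) in
  search n asg ts -> agrees asg ->
  all (has (fun c : position => agrees c.1)) ts ->
  4 <= n + count (has (fun c : position => agrees c.1 && c.2)) ts.
Proof.
move=> agrees; elim: ts n asg => [|t ts IH] n asg /=; first by case: ifP => // n4 _ _ _; rewrite addn0.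
case: ifP => [n4 _ _ _|_ /allP br sasg /andP[/hasP[c ct sc] sts]].
  exact: leq_trans n4 (leq_addr _ _).
have := br c ct; case: ifP => [_|/negP[]].
  have cat : agrees (c.1 ++ asg) by rewrite /agrees all_cat; apply/andP.
  move=> /IH /(_ cat sts) h; apply: leq_trans h _; rewrite -addnA leq_add2l leq_add2r.
  by case c2: (c.2) => //; rewrite lt0b; apply/hasP; exists c; rewrite ?sc ?c2.
apply/allP => l lc; apply/allP => m masg; apply/implyP => /eqP kml.
by rewrite -(eqP (allP sasg m masg)) kml (eqP (allP sc l lc)).
Qed.

Lemma explore_sound (l : seq bool) n :
  n <= size l -> all (monotone_quad l) quads ->
  explore n (take (size l - n) l) ->
  check (entry (tabulate (alternate (increasing_sign l)))).
Proof.
move=> + ql; elim: n => [|n IH] nl; first by rewrite subn0 take_size.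
rewrite /explore -/explore => /allP /(_ (nth true l (size l - n.+1))).
have lt : (size l - n.+1 < size l) by rewrite ltn_subrL /=; case: (l) nl.
have -> : rcons (take (size l - n.+1) l) (nth true l (size l - n.+1)) = take (size l - n) l.
  by rewrite -take_nth // subnSK.
have ltb b : b \in [:: true; false] by case: b.
move=> /(_ (ltb _)); case: ifP => [_ /(IH (ltnW nl))//|/negP[]].
apply/allP => q qq; have := allP ql q qq.
have : all (fun q : nat * nat * nat * nat =>
    [&& q.1.1.1 < q.2, q.1.1.2 < q.2 & q.1.2 < q.2]) quads by [].
move=> /allP /(_ q qq); case: q qq => [[[q1 q2] q3] q4] _ /and3P[/= h1 h2 h3] m.
apply/implyP; rewrite /monotone_quad size_takel ?leq_subr // => /eqP sz.
by rewrite !nth_take -?sz ?ltnS ?(ltnW h1) ?(ltnW h2) ?(ltnW h3).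
Qed.

(** * Orientations in the plane *)

Section Geometry.
Local Open Scope ring_scope.
Variable R : realFieldType.
Implicit Types p q r z : R * R.

Definition orient p q r : R :=
  (q.1 - p.1) * (r.2 - p.2) - (q.2 - p.2) * (r.1 - p.1).

Lemma orient_rot p q r : orient q r p = orient p q r.
Proof. rewrite /orient; ring. Qed.

(** The search records a degenerate sign as negative, or as positive after a
    change of orientation; only a weak sign is known of the determinants on which
    it branches. *)
Definition wsign (b : bool) (x : R) := if b then 0 <= x else x <= 0.

Definition ssign (b : bool) (x : R) := if b then 0 < x else x < 0.

Lemma ssignE x : x != 0 -> ssign (0 < x) x.
Proof. by move=> x0; rewrite /ssign; case: ltgtP x0. Qed.

Lemma ssign_eq b x : ssign b x -> b = (0 < x).
Proof. by case: b => /= h; case: ltgtP h. Qed.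

Lemma ssignW b x : ssign b x -> wsign b x.
Proof. by case: b => /= /ltW. Qed.

Lemma wsignN b x : wsign (~~ b) (- x) = wsign b x.
Proof. by case: b; rewrite /= ?oppr_ge0 ?oppr_le0. Qed.

Lemma wsignM b c x y : wsign b x -> ssign c y -> wsign (b == c) (x * y).
Proof. case: b; case: c => /= h1 h2; nra. Qed.

Lemma ssignM b c x y : ssign b x -> ssign c y -> ssign (b == c) (x * y).
Proof. case: b; case: c => /= h1 h2; nra. Qed.

Lemma ssign_neq0 b x : ssign b x -> x != 0.
Proof. by case: b => /= h; [exact: lt0r_neq0|exact: ltr0_neq0]. Qed.

Lemma wsign_gt0 x : wsign (0 < x) x.
Proof. by case: (ltP 0 x) => /= [/ltW|]. Qed.

(** * Crossing points of segments *)

Definition between t p q : R * R := (p.1 + t * (q.1 - p.1), p.2 + t * (q.2 - p.2)).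

Lemma orient_between t p q x y :
  orient x y (between t p q) = (1 - t) * orient x y p + t * orient x y q.
Proof. rewrite /orient /=; ring. Qed.

Lemma side_between t p q x y b c : 0 < t < 1 -> ssign c (orient x y p) -> ssign c (orient x y q) ->
  wsign b (orient x y (between t p q)) -> b = c.
Proof. move=> /andP[t0 t1]; rewrite orient_between; case: b c => [] [] //= h1 h2 h3; nra. Qed.

(** The pattern of signs that is excluded is the one of
    [corner_consistent1]. *)
Lemma corner_between t q o x y z (u v s1 s2 s3 s4 : bool) :
  0 < t < 1 -> let p := between t q o in
  wsign u (orient x y p) -> wsign v (orient x z p) ->
  ssign s1 (orient x z q) -> ssign s2 (orient x y q) -> ssign s3 (orient x o q) -> ssign s4 (orient x y z) ->
  ~~ (((u != s1) == (v == s2)) && ((v == s2) == (s3 == s4))).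
Proof.
move=> /andP[t0 t1] p hu hv h1 h2 h3 h4; apply/negP => /andP[/eqP e1 /eqP e2].
have gp : orient x y p * orient x z q = orient x z p * orient x y q + t * (orient x o q * orient x y z).
  rewrite /p /orient /=; ring.
have := ssignM h3 h4; have := wsignM hv h2; have := wsignM hu h1.
have -> : (u == s1) = ~~ (v == s2) by rewrite -e1 negbK.
rewrite -e2 gp; case: (v == s2) => /=; move: (orient x z p * _) (orient x o q * _) => a b; nra.
Qed.

(** When the lines ab and cd cross, ab is divided in the ratio of the oriented
    distances of its ends from cd. *)
Definition crossing_param a b c d := orient a c d / (orient a c d - orient b c d).
Definition crossing a b c d := between (crossing_param a b c d) a b.

(** The determinant of the lines ab, cd, xy in homogeneous coordinates; it is
    alternating in the three lines. *)
Definition concur a b c d x y :=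
  orient a c d * orient b x y - orient b c d * orient a x y.

Lemma crossing_param01 a b c d s :
  ssign s (orient a c d) -> ssign (~~ s) (orient b c d) -> 0 < crossing_param a b c d < 1.
Proof.
rewrite /crossing_param; move: (orient a c d) (orient b c d) => x y; case: s => /= hx hy.
  by rewrite divr_gt0 ?ltr_pdivrMr ?mul1r; lra.
rewrite -[x / _]mulrNN -invrN divr_gt0 ?ltr_pdivrMr; lra.
Qed.

Lemma crossingC a b c d s t :
  ssign s (orient a c d) -> ssign (~~ s) (orient b c d) ->
  ssign t (orient c a b) -> ssign (~~ t) (orient d a b) -> crossing c d a b = crossing a b c d.
Proof.
move=> h1 h2 h3 h4.
have n1 : orient a c d - orient b c d != 0 by apply/eqP; case: s h1 h2 => /=; lra.
have n2 : orient c a b - orient d a b != 0 by apply/eqP; case: t h3 h4 => /=; lra.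
rewrite /crossing /crossing_param /between; move: n1 n2; rewrite /orient => n1 n2.
by congr (_, _); field; rewrite n1 n2.
Qed.

(** The orientation of x, y and the crossing point is [concur] divided by
    [orient a c d - orient b c d], which has the sign of [orient a c d]. *)
Lemma wsign_concur a b c d x y s u :
  ssign s (orient a c d) -> ssign (~~ s) (orient b c d) ->
  wsign u (concur a b c d x y) -> wsign (u == s) (orient x y (crossing a b c d)).
Proof.
move=> h1 h2 h.
have n1 : orient a c d - orient b c d != 0 by apply/eqP; case: s h1 h2 {h} => /=; lra.
have -> : orient x y (crossing a b c d) = concur a b c d x y * (orient a c d - orient b c d)^-1.
  by move: n1; rewrite /crossing /crossing_param /concur /orient /= => n1; field.
apply: wsignM => //; case: s h1 h2 {h} => /= h1 h2; rewrite ?invr_gt0 ?invr_lt0; lra.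
Qed.

Lemma concur_swap a b c d x y : concur a b x y c d = - concur a b c d x y.
Proof. rewrite /concur /orient; ring. Qed.

Lemma concur_rot a b c d x y : concur x y a b c d = concur a b c d x y.
Proof. rewrite /concur /orient; ring. Qed.

(** * Convex hulls of labelled points *)

Variable pt : nat -> R * R.
Notation D a b c := (orient (pt a) (pt b) (pt c)).

Definition in_hull (B : seq nat) z := exists w : nat -> R,
  [/\ forall i, i \in B -> 0 <= w i, \sum_(i <- B) w i = 1,
      \sum_(i <- B) w i * (pt i).1 = z.1 & \sum_(i <- B) w i * (pt i).2 = z.2].

Definition blocks_meet (Bs : seq (seq nat)) := exists z, forall B, B \in Bs -> in_hull B z.

Lemma in_hull1 a : in_hull [:: a] (pt a).
Proof. by exists (fun=> 1); split=> //; rewrite big_seq1 ?mul1r. Qed.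

Lemma in_hull2 a b t : a != b -> 0 <= t <= 1 ->
  in_hull [:: a; b] ((pt a).1 + t * ((pt b).1 - (pt a).1), (pt a).2 + t * ((pt b).2 - (pt a).2)).
Proof.
move=> ab /andP[t0 t1].
exists (fun i => if i == a then 1 - t else t); split => [i _||/=|/=].
- by case: ifP; rewrite ?subr_ge0.
all: rewrite !(big_cons, big_nil) /= eqxx eq_sym (negbTE ab); ring.
Qed.

(** The orientations of z with the sides add up to the orientation of the
    triangle, and their quotients by it are the barycentric coordinates. *)
Lemma in_hull3 a b c t z : uniq [:: a; b; c] -> D a b c != 0 ->
  wsign t (orient (pt a) (pt b) z) -> wsign t (orient (pt b) (pt c) z) -> wsign t (orient (pt c) (pt a) z) ->
  in_hull [:: a; b; c] z.
Proof.
rewrite /= !inE negb_or => /and3P[/andP[ab ac] bc _] n0 h1 h2 h3.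
have [E1 E2 E3] : [/\ (b == a) = false, (c == a) = false & (c == b) = false].
  by rewrite ![_ == a]eq_sym ![c == _]eq_sym !(negbTE ab, negbTE ac, negbTE bc).
have s : orient (pt b) (pt c) z + orient (pt c) (pt a) z + orient (pt a) (pt b) z = D a b c by rewrite /orient; ring.
have ge0 x : wsign t x -> 0 <= x / D a b c.
  case: t h1 h2 h3 => /= h1 h2 h3 hx.
    apply: divr_ge0 => //; rewrite -s; lra.
  by apply: mulr_le0 => //; rewrite invr_le0 -s; lra.
exists (fun i => if i == a then orient (pt b) (pt c) z / D a b c else
   if i == b then orient (pt c) (pt a) z / D a b c else orient (pt a) (pt b) z / D a b c); split.
- by move=> i _; case: ifP => _; [|case: ifP => _]; apply: ge0.
- rewrite !(big_cons, big_nil) /= !eqxx E1 E2 E3.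
  by rewrite addr0 -!mulrDl addrA s divff.
all: rewrite !(big_cons, big_nil) /= !eqxx E1 E2 E3.
all: move: n0; rewrite /orient => n0; field; exact: n0.
Qed.
End Geometry.

(** * What a successful check means *)

Section Labelled.
Local Open Scope ring_scope.
Variables (R : realFieldType) (pt : nat -> R * R) (s : nat -> nat -> nat -> bool).
Notation D a b c := (orient (pt a) (pt b) (pt c)).
Hypothesis sP : forall a b c, uniq [:: a; b; c] -> all (fun i => i < 7)%N [:: a; b; c] ->
  ssign (s a b c) (D a b c).

Lemma crossing_shape B : B \in crossings ->
  exists a b c d e f g, [/\ B = [:: [:: e; f; g]; [:: a; b]; [:: c; d]],
    uniq [:: a; b; c; d; e; f; g] &
    all (fun i => i < 7)%N [:: a; b; c; d; e; f; g]].
Proof.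
pose ok (B : seq (seq nat)) := if B is [:: [:: e; f; g]; [:: a; b]; [:: c; d]] then
  uniq [:: a; b; c; d; e; f; g] &&
  all (fun i => i < 7)%N [:: a; b; c; d; e; f; g] else false.
have /allP h : all ok crossings by vm_compute.
move=> /h; rewrite /ok.
case: B => [|[|e [|f [|g []]]] [|[|a [|b []]] [|[|c [|d []]] []]]] //.
case/andP => h1 h2.
by exists a, b, c, d, e, f, g.
Qed.

Lemma star_shape B : B \in stars ->
  exists p a b c d e f, [/\ B = [:: [:: p]; [:: a; b; c]; [:: d; e; f]],
    uniq [:: p; a; b; c; d; e; f] & all (fun i => i < 7)%N [:: p; a; b; c; d; e; f]].
Proof.
pose ok (B : seq (seq nat)) := if B is [:: [:: p]; [:: a; b; c]; [:: d; e; f]] then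
  uniq [:: p; a; b; c; d; e; f] && all (fun i => i < 7)%N [:: p; a; b; c; d; e; f] else false.
have /allP h : all ok stars by vm_compute.
move=> /h; rewrite /ok.
case: B => [|[|p []] [|[|a [|b [|c []]]] [|[|d [|e [|f []]]] []]]] //.
case/andP => h1 h2.
by exists p, a, b, c, d, e, f.
Qed.

Lemma star_sound B : B \in stars -> star_ok s B -> blocks_meet pt B.
Proof.
move=> /star_shape[p [a [b [c [d [e [f [-> U L]]]]]]]] /= /andP[].
have tri x y z : uniq [:: p; x; y; z] -> all (fun i => i < 7)%N [:: p; x; y; z] ->
    in_triangle s p x y z -> in_hull pt [:: x; y; z] (pt p).
  move=> U4 /= /and5P[Lp Lx Ly Lz _] /andP[/eqP e1 /eqP e2].
  move: U4 => /= /and4P[]; rewrite !inE !negb_or => /and3P[px py pz] /andP[xy xz] yz _.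
  have S i j k : [&& i != j, i != k & j != k] -> [&& i < 7, j < 7 & k < 7]%N -> ssign (s i j k) (D i j k).
    move=> /and3P[ij ik jk] /and3P[h1 h2 h3]; apply: sP; rewrite /= ?h1 ?h2 ?h3 //.
    by rewrite !inE negb_or ij ik jk.
  apply: (@in_hull3 _ _ _ _ _ (s x y p)).
  - by rewrite /= !inE negb_or xy xz yz.
  - by apply: (@ssign_neq0 _ (s x y z)); apply: S; rewrite ?xy ?xz ?yz ?Lx ?Ly ?Lz.
  - by apply: ssignW; apply: S; rewrite ?xy ?[_ == p]eq_sym ?px ?py ?Lx ?Ly ?Lp.
  - by rewrite e1; apply: ssignW; apply: S; rewrite ?yz ?[_ == p]eq_sym ?pz ?py ?Lz ?Ly ?Lp.
  - by rewrite e1 e2; apply: ssignW; apply: S; rewrite ?[z == x]eq_sym ?xz ?[_ == p]eq_sym ?pz ?px ?Lz ?Lx ?Lp.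
have sub i j k : subseq [:: p; i; j; k] [:: p; a; b; c; d; e; f] ->
    uniq [:: p; i; j; k] /\ all (fun i => i < 7)%N [:: p; i; j; k].
  move=> ss; split; first exact: subseq_uniq ss U.
  by apply/allP => i' /(mem_subseq ss); apply: (allP L).
have s1 : subseq [:: p; a; b; c] [:: p; a; b; c; d; e; f] by rewrite /= !eqxx.
have s2 : subseq [:: p; d; e; f] [:: p; a; b; c; d; e; f].
  by rewrite -[X in subseq _ X]/([:: p] ++ [:: a; b; c] ++ [:: d; e; f]) (cat_subseq (subseq_refl [:: p])) // suffix_subseq.
move=> /(tri _ _ _ (sub _ _ _ s1).1 (sub _ _ _ s1).2) h1.
move=> /(tri _ _ _ (sub _ _ _ s2).1 (sub _ _ _ s2).2) h2.
exists (pt p) => B'; rewrite !inE => /or3P[] /eqP -> //; exact: in_hull1.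
Qed.

(** The actual signs of the determinants on which the search branches. *)
Definition sigma (k : seq nat) : bool :=
  if k is [:: a; b; c; d; e; f] then 0 < concur (pt a) (pt b) (pt c) (pt d) (pt e) (pt f) else true.

Lemma wsign_sorted_lines a b c d x y : let: (k, even) := sorted_lines a b c d x y in
  wsign (sigma k == even) (concur (pt a) (pt b) (pt c) (pt d) (pt x) (pt y)).
Proof.
rewrite /sorted_lines; case: ifP => _; last case: ifP => _; rewrite /sigma /= ?eqb_id ?eqbF_neg.
- by rewrite -(concur_rot (pt a)); exact: wsign_gt0.
- by rewrite (concur_swap _ _ (pt x) (pt y)) wsignN; exact: wsign_gt0.
- exact: wsign_gt0.
Qed.

Definition actual_side a b c d x y : bool :=
  let: (k, even) := sorted_lines a b c d x y in sigma k == (s a c d == even).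

Lemma side_literalE a b c d x y u :
  (sigma (side_literal s a b c d x y u).1 == (side_literal s a b c d x y u).2) = (u == actual_side a b c d x y).
Proof.
rewrite /side_literal /actual_side; case: (sorted_lines _ _ _ _ _ _) => k even /=.
by case: (sigma k); case: u; case: (s _ _ _); case: even.
Qed.

Lemma wsign_actual a b c d x y :
  ssign (s a c d) (D a c d) -> ssign (~~ s a c d) (D b c d) ->
  wsign (actual_side a b c d x y) (orient (pt x) (pt y) (crossing (pt a) (pt b) (pt c) (pt d))).
Proof.
move=> h1 h2; have := wsign_sorted_lines a b c d x y; rewrite /actual_side.
case: (sorted_lines _ _ _ _ _ _) => k even h.
have -> : (sigma k == (s a c d == even)) = ((sigma k == even) == s a c d).
  by case: {h} (sigma k); case: (s _ _ _); case: (even).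
exact: wsign_concur.
Qed.

Section OneCrossing.
Variables a b c d e f g : nat.
Hypothesis U : uniq [:: a; b; c; d; e; f; g].
Hypothesis L : all (fun i => i < 7)%N [:: a; b; c; d; e; f; g].
Hypothesis X : segments_cross s a b c d.
Let z := crossing (pt a) (pt b) (pt c) (pt d).

Let S i j k : i \in [:: a; b; c; d; e; f; g] -> j \in [:: a; b; c; d; e; f; g] ->
  k \in [:: a; b; c; d; e; f; g] -> uniq [:: i; j; k] -> ssign (s i j k) (D i j k).
Proof. by move=> /(allP L) h1 /(allP L) h2 /(allP L) h3 u; apply: sP; rewrite //= h1 h2 h3. Qed.

(* Labels at different places are different; [nE] rewrites all these tests. *)
Let NE i j : (i < j < 7)%N ->
  let x := nth 0 [:: a; b; c; d; e; f; g] in ((x i == x j) = false) * ((x j == x i) = false).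
Proof.
move=> /andP[ij j7]; have i7 := ltn_trans ij j7.
by split; rewrite nth_uniq //; apply/eqP => h; move: ij; rewrite h ltnn.
Qed.
Let nE := (@NE 0 1 isT, @NE 0 2 isT, @NE 0 3 isT, @NE 0 4 isT, @NE 0 5 isT, @NE 0 6 isT,
  (@NE 1 2 isT, @NE 1 3 isT, @NE 1 4 isT, @NE 1 5 isT, @NE 1 6 isT,
  @NE 2 3 isT, @NE 2 4 isT, @NE 2 5 isT, @NE 2 6 isT),
  (@NE 3 4 isT, @NE 3 5 isT, @NE 3 6 isT, @NE 4 5 isT, @NE 4 6 isT, @NE 5 6 isT)).

Ltac labels := by rewrite /= ?inE ?eqxx ?orbT ?nE.

Let A1 : ssign (s a c d) (D a c d). Proof. apply: S; labels. Qed.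
Let A2 : ssign (~~ s a c d) (D b c d).
Proof.
have -> : s a c d = s c d a.
  by rewrite (ssign_eq A1) -(orient_rot (pt a)); apply/esym/ssign_eq; apply: S; labels.
move: X => /andP[_]; case: (s c d a) (s c d b) (@S c d b) => [] [] //= h _;
  by rewrite -orient_rot; apply: h; labels.
Qed.
Let A3 : ssign (s a b c) (D c a b). Proof. rewrite -orient_rot; apply: S; labels. Qed.
Let A4 : ssign (~~ s a b c) (D d a b).
Proof.
move: X => /andP[+ _]; case: (s a b c) (s a b d) (@S a b d) => [] [] //= h _;
  by rewrite -orient_rot; apply: h; labels.
Qed.

Let ends := [:: (a, b); (b, a); (c, d); (d, c)].
(* The relations at a corner use the crossing point as seen from each of the four
   ends. *)
Let betw q o : (q, o) \in ends -> exists2 t, 0 < t < 1 & z = between t (pt q) (pt o).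
Proof.
have flip t p q' : between (1 - t) q' p = between t p q'.
  by rewrite /between; congr (_, _); ring.
have flip01 (t : R) : 0 < t < 1 -> 0 < 1 - t < 1 by move=> /andP[? ?]; apply/andP; split; lra.
have h1 := crossing_param01 A1 A2; have h2 := crossing_param01 A3 A4.
have zE : z = between (crossing_param (pt c) (pt d) (pt a) (pt b)) (pt c) (pt d).
  by rewrite /z -(crossingC A1 A2 A3 A4).
rewrite !inE => /or4P[] /eqP[-> ->].
- by exists (crossing_param (pt a) (pt b) (pt c) (pt d)).
- by exists (1 - crossing_param (pt a) (pt b) (pt c) (pt d)); rewrite ?flip01 ?flip.
- by exists (crossing_param (pt c) (pt d) (pt a) (pt b)).
- by exists (1 - crossing_param (pt c) (pt d) (pt a) (pt b)); rewrite ?flip01 ?flip.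
Qed.

Let out := [:: e; f; g].
Let inn := [:: a; b; c; d].
Let S1 x y q : x \in out -> y \in out -> x != y -> q \in inn -> ssign (s x y q) (D x y q).
Proof.
rewrite !inE => /or3P[] /eqP -> /or3P[] /eqP ->; rewrite ?eqxx // => _;
  case/or4P => /eqP ->; apply: S; labels.
Qed.
Let S2 x q o : x \in out -> (q, o) \in ends -> ssign (s x q o) (D x q o).
Proof.
rewrite !inE => /or3P[] /eqP -> /or4P[] /eqP[-> ->]; apply: S; labels.
Qed.

Lemma edge_sound x y u : x \in out -> y \in out -> x != y ->
  wsign u (orient (pt x) (pt y) z) -> edge_consistent s a b c d x y u.
Proof.
move=> xo yo xy h.
have side q o : (q, o) \in ends -> q \in inn -> o \in inn ->
    (s x y q == s x y o) ==> (u == s x y q).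
  move=> qo qi oi; apply/implyP => /eqP e1; apply/eqP; have [t t01 ez] := betw qo.
  move: h; rewrite ez => h; apply: (side_between t01 _ _ h); first exact: S1.
  by rewrite e1; apply: S1.
by rewrite /edge_consistent; apply/andP; split; apply: side; labels.
Qed.

Lemma corner_sound x y w u v : x \in out -> y \in out -> w \in out -> uniq [:: x; y; w] ->
  wsign u (orient (pt x) (pt y) z) -> wsign v (orient (pt x) (pt w) z) ->
  corner_consistent s a b c d x y w u v.
Proof.
move=> xo yo wo uq hu hv.
have mo i : i \in out -> i \in [:: a; b; c; d; e; f; g].
  by rewrite !inE => /or3P[] /eqP ->; rewrite eqxx !orbT.
have xyw : ssign (s x y w) (D x y w) by apply: S => //; apply: mo.
move: uq; rewrite /= !inE negb_or andbT => /andP[/andP[xy xw] yw].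
have one q o : (q, o) \in ends -> q \in inn -> corner_consistent1 s q o x y w u v.
  move=> qo qi; have [t t01 ez] := betw qo.
  move: hu hv; rewrite ez => hu hv.
  apply: (corner_between t01 hu hv) xyw; [exact: S1|exact: S1|].
  apply: S2 => //; move: qo; rewrite !inE => /or4P[] /eqP[-> ->]; rewrite !eqxx ?orbT //.
by rewrite /corner_consistent; apply/and4P; split; apply: one; labels.
Qed.

Let actual := (actual_side a b c d e f, actual_side a b c d f g, ~~ actual_side a b c d e g).

Let N1 : wsign (actual_side a b c d e f) (orient (pt e) (pt f) z). Proof. exact: wsign_actual. Qed.
Let N2 : wsign (actual_side a b c d f g) (orient (pt f) (pt g) z). Proof. exact: wsign_actual. Qed.
Let N3 : wsign (~~ actual_side a b c d e g) (orient (pt g) (pt e) z).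
Proof.
have -> : orient (pt g) (pt e) z = - orient (pt e) (pt g) z by rewrite /orient; ring.
rewrite wsignN; exact: wsign_actual.
Qed.
Let rev x y u : wsign u (orient (pt x) (pt y) z) -> wsign (~~ u) (orient (pt y) (pt x) z).
Proof. by have -> : orient (pt y) (pt x) z = - orient (pt x) (pt y) z; [rewrite /orient; ring|rewrite wsignN]. Qed.

Lemma actual_consistent : consistent_position s a b c d e f g actual.
Proof.
apply/and5P; split; last (apply/andP; split).
- by apply: edge_sound N1; labels.
- by apply: edge_sound N2; labels.
- by apply: edge_sound N3; labels.
- by apply: corner_sound N1 (rev N3); labels.
- by apply: corner_sound N2 (rev N1); labels.
- by apply: corner_sound N3 (rev N2); labels.
Qed.

Lemma literals_actual o : all (fun l => sigma l.1 == l.2) (position_literals s a b c d e f g o) = (o == actual).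
Proof.
case: o => [[u v] w]; rewrite /position_literals /actual /= !side_literalE andbT !xpair_eqE -andbA.
by congr [&& _, _ & _]; case: w; case: (actual_side _ _ _ _ _ _).
Qed.

Lemma crossing_sound :
  has (fun ch => all (fun l => sigma l.1 == l.2) ch.1 && ch.2) (positions s [:: [:: e; f; g]; [:: a; b]; [:: c; d]]) ->
  blocks_meet pt [:: [:: e; f; g]; [:: a; b]; [:: c; d]].
Proof.
move=> /hasP[ch /mapP[o _ ->]] /=; rewrite literals_actual => /andP[/eqP -> /eqP].
rewrite /actual => -[h1 h2 h3].
exists z => B; rewrite !inE => /or3P[] /eqP ->.
- apply: (@in_hull3 _ _ _ _ _ (s e f g)).
  + labels.
  + by apply: (@ssign_neq0 _ (s e f g)); apply: S; labels.
  + by rewrite -{1}h1.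
  + by rewrite -h2.
  + by rewrite -h3.
- by have /andP[t0 t1] := crossing_param01 A1 A2; apply: in_hull2; rewrite ?nE // !ltW.
- have /andP[t0 t1] := crossing_param01 A3 A4; rewrite /z -(crossingC A1 A2 A3 A4).
  by apply: in_hull2; rewrite ?nE // !ltW.
Qed.

Lemma positions_actual :
  has (fun ch => all (fun l => sigma l.1 == l.2) ch.1) (positions s [:: [:: e; f; g]; [:: a; b]; [:: c; d]]).
Proof.
apply/hasP; exists (position_literals s a b c d e f g actual, actual == (s e f g, s e f g, s e f g)).
  apply/mapP; exists actual => //; rewrite mem_filter actual_consistent.
  by case: actual => [[[] []] []].
by rewrite literals_actual.
Qed.
End OneCrossing.

(** The stars that meet are read off from the sign pattern. By [search_sound], the
    other splittings counted are crossings whose actual position is one that puts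
    the crossing point in the triangle. *)
Lemma check_sound : check s ->
  exists S : seq (seq (seq nat)), [/\ (4 <= size S)%N, subseq S (stars ++ crossings) &
     forall B, B \in S -> blocks_meet pt B].
Proof.
move=> /(search_sound (sigma := sigma)) /(_ isT) h.
pose good ch := has (fun ch : seq (seq nat * bool) * bool => all (fun l => sigma l.1 == l.2) ch.1 && ch.2) ch.
exists ([seq B <- stars | star_ok s B] ++ [seq B <- crossings | may_meet s B && good (positions s B)]).
split.
- rewrite size_cat !size_filter; apply: leq_trans (h _) _.
    apply/allP => ch /mapP[B]; rewrite mem_filter => /andP[+ Bc] ->.
    have [a [b [c [d [e [f [g [-> U L]]]]]]]] := crossing_shape Bc.
    by move=> /andP[X _]; apply: positions_actual.
  by rewrite leq_add2l count_map count_filter; apply: sub_count => B /= /andP[h1 ->].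
- by rewrite cat_subseq ?filter_subseq.
move=> B; rewrite mem_cat !mem_filter => /orP[/andP[? ?]|]; first exact: star_sound.
move=> /andP[/andP[+ +] Bc].
have [a [b [c [d [e [f [g [-> U L]]]]]]]] := crossing_shape Bc.
by move=> /andP[X _] h2; apply: crossing_sound.
Qed.
End Labelled.

(** * Seven points seen from a vertex of their hull *)

Section Fan.
Local Open Scope ring_scope.
Variables (R : realFieldType) (pt : nat -> R * R).
Notation D a b c := (orient (pt a) (pt b) (pt c)).
Hypothesis general : forall a b c, uniq [:: a; b; c] -> all (fun i => i < 7)%N [:: a; b; c] -> D a b c != 0.
Hypothesis fan : forall i j, (0 < i < j)%N -> (j < 7)%N -> 0 < D 0%N i j.

Let pos (t : nat * nat * nat) : bool := 0 < D t.1.1 t.1.2 t.2.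
Let l0 := map pos triples.

Lemma l0E i j k : (0 < i)%N -> (i < j < k)%N -> (k < 7)%N -> nth true l0 (triple_index i j k) = pos (i, j, k).
Proof.
move=> i0 /andP[ij jk] k7.
have tin : (i, j, k) \in triples.
  apply/allpairsPdep; exists k, (i, j, k); split => //; first by rewrite mem_iota; lia.
  apply/allpairsPdep; exists j, i; split => //; rewrite mem_iota; lia.
by rewrite (nth_map (0, 0, 0)%N) ?nth_index // index_mem.
Qed.

Lemma entry_tabulate f a b c : (a < 7)%N -> (b < 7)%N -> (c < 7)%N -> entry (tabulate f) a b c = f a b c.
Proof. by move=> ha hb hc; rewrite /entry !nth_mkseq. Qed.

Lemma entry_sign a b c : uniq [:: a; b; c] -> all (fun i => i < 7)%N [:: a; b; c] ->
  ssign (entry (tabulate (alternate (increasing_sign l0))) a b c) (D a b c).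
Proof.
have B i j k : (i < j < k)%N -> (k < 7)%N -> increasing_sign l0 i j k = (0 < D i j k).
  move=> /andP[ij jk] k7; rewrite /increasing_sign; case: eqP => [i0|/eqP]; last first.
    by rewrite -lt0n => i0; rewrite l0E // ij.
  by subst i; rewrite fan ?ij.
have neg i j k : (i < j < k)%N -> (k < 7)%N -> ~~ (0 < D i j k) = (0 < - D i j k).
  move=> /andP[ij jk] k7; rewrite oppr_gt0 -leNgt le_eqVlt; case: eqP => // /eqP.
  have h : all (fun i => i < 7)%N [:: i; j; k] by rewrite /=; lia.
  by rewrite (negbTE (general _ h)) //= !inE; lia.
move=> U L; have n0 := general U L.
suff -> : entry (tabulate (alternate (increasing_sign l0))) a b c = (0 < D a b c) by exact: ssignE.
move: L => /= /and4P[a7 b7 c7 _]; move: U => /=; rewrite !inE negb_or => /and3P[/andP[ab ac] bc _].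
rewrite entry_tabulate // /alternate.
have [e1 e2 e3] : [/\ D a b c = - D a c b, D a b c = D c a b & D a b c = - D b a c].
  by rewrite /orient; split; ring.
have [e4 e5] : D a b c = D b c a /\ D a b c = - D c b a by rewrite /orient; split; ring.
case: ifP => h1; [case: ifP => h2; [|case: ifP => h3]|case: ifP => h2; [|case: ifP => h3]].
- by rewrite B; lia.
- by rewrite e1 B ?neg; lia.
- by rewrite e2 B; lia.
- by rewrite e3 B ?neg; lia.
- by rewrite e4 B; lia.
- by rewrite e5 B ?neg; lia.
Qed.

(** In the Grassmann-Plucker relation with pivot i and the points 0, j, k, l, the
    factors that contain 0 have known signs. What is left has the form
    A * D i k l + C * D i j k = B * D i j l with A, B, C > 0 and excludes
    alternating signs. The pivots j, k, l treat the other triples of terms. *)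
Lemma quad_monotone i j k l : (0 < i < j)%N -> (j < k < l)%N -> (l < 7)%N ->
  monotone (pos (i, j, k)) (pos (i, j, l)) (pos (i, k, l)) (pos (j, k, l)).
Proof.
move=> /andP[i0 ij] /andP[jk kl] l7.
have sgn x y z : (0 < x)%N -> (x < y < z)%N -> (z < 7)%N -> ssign (pos (x, y, z)) (D x y z).
  move=> x0 xyz z7; apply: ssignE; apply: general => /=; rewrite ?inE; lia.
have F x y : (0 < x < y)%N -> (y < 7)%N -> 0 < D 0%N x y by exact: fan.
have alt A B C x y z b1 b2 b3 : 0 < A -> 0 < B -> 0 < C -> A * z + C * x = B * y ->
    ssign b1 x -> ssign b2 y -> ssign b3 (z : R) -> alternates b1 b2 b3 = false.
  by case: b1 b2 b3 => [] [] [] //= A0 B0 C0 e h1 h2 h3; exfalso; nra.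
have s1 := sgn i j k; have s2 := sgn i j l; have s3 := sgn i k l; have s4 := sgn j k l.
apply/norP; split; last (apply/norP; split; last (apply/norP; split)); apply/negbT.
- apply: (alt (D 0%N i j) (D 0%N i k) (D 0%N i l)) (s1 _ _ _) (s2 _ _ _) (s3 _ _ _); try (by apply: F; lia); try lia.
  by rewrite /orient; ring.
- apply: (alt (D 0%N i j) (D 0%N j k) (D 0%N j l)) (s1 _ _ _) (s2 _ _ _) (s4 _ _ _); try (by apply: F; lia); try lia.
  by rewrite /orient; ring.
- apply: (alt (D 0%N i k) (D 0%N j k) (D 0%N k l)) (s1 _ _ _) (s3 _ _ _) (s4 _ _ _); try (by apply: F; lia); try lia.
  by rewrite /orient; ring.
- apply: (alt (D 0%N i l) (D 0%N j l) (D 0%N k l)) (s2 _ _ _) (s3 _ _ _) (s4 _ _ _); try (by apply: F; lia); try lia.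
  by rewrite /orient; ring.
Qed.

Lemma quads_monotone : all (monotone_quad l0) quads.
Proof.
have nthE := l0E; clearbody l0.
apply/allP => q /allpairsPdep[l [t [+ + ->]]].
rewrite mem_filter mem_iota => l7 /andP[+ /allpairsPdep[k [t' [k0 + e]]]]; subst t' => + /allpairsPdep[j [i [+ + e]]].
subst t => /= kl; rewrite !mem_iota => jk ij.
have /and5P[m1 m2 m3 m4 m5] : [&& 0 < i, i < j, j < k, k < l & l < 7]%N by lia.
(* Stated on variables, so that the indices are only compared as written. *)
have E x1 x2 x3 x4 y1 y2 y3 y4 : x1 = y1 -> x2 = y2 -> x3 = y3 -> x4 = y4 ->
    monotone y1 y2 y3 y4 -> monotone x1 x2 x3 x4 by move=> -> -> -> ->.
apply: (E _ _ _ _ _ _ _ _ (nthE _ _ _ _ _ _) (nthE _ _ _ _ _ _) (nthE _ _ _ _ _ _) (nthE _ _ _ _ _ _));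
  last apply: quad_monotone; lia.
Qed.

Lemma fan_four : exists S : seq (seq (seq nat)),
  [/\ (4 <= size S)%N, subseq S (stars ++ crossings) & forall B, B \in S -> blocks_meet pt B].
Proof.
apply: (check_sound entry_sign); apply: (@explore_sound l0 20); [by []|exact: quads_monotone|].
by rewrite size_map subnn take0; exact: explore_all.
Qed.
End Fan.

(** * From splittings of labels to partitions of a finite type *)

Section SetHull.
Local Open Scope ring_scope.
Variables (R : realFieldType) (I : finType) (x : I -> R * R).

Definition set_hull (B : {set I}) (z : R * R) :=
  exists w : I -> R, [/\ forall i, 0 <= w i, \sum_(i in B) w i = 1,
    \sum_(i in B) w i * (x i).1 = z.1 & \sum_(i in B) w i * (x i).2 = z.2].

Definition meeting (P : {set {set I}}) :=
  exists z, forall B, B \in P -> set_hull B z.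
End SetHull.

Section Labelling.
Local Open Scope ring_scope.
Variables (I : finType) (e : seq I).
Hypothesis (ue : uniq e) (se : size e = 7%N) (me : forall i, i \in e).

Definition block (B : seq nat) : {set I} := [set i | index i e \in B].
Definition set_partition (Bs : seq (seq nat)) : {set {set I}} := [set:: map block Bs].

(** The equivalence relation of a splitting, as a list; it can be compared by
    computation and determines the partition. *)
Definition separation (Bs : seq (seq nat)) : seq bool :=
  [seq has (fun B : seq nat => (i \in B) && (j \in B)) Bs | i <- iota 0 7, j <- iota 0 7].
Definition proper (Bs : seq (seq nat)) : bool :=
  [&& size Bs == 3%N, perm_eq (flatten Bs) (iota 0 7) & [::] \notin Bs].

Lemma index_lt7 i : (index i e < 7)%N. Proof. by rewrite -se index_mem me. Qed.
Lemma index_inj : injective (fun i => index i e).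
Proof. by move=> i j /(congr1 (nth i e)); rewrite !nth_index. Qed.
Lemma index_onto k : (k < 7)%N -> exists i, index i e = k.
Proof.
have : I by case: (e) se => // x.
by move=> x0 k7; exists (nth x0 e k); rewrite index_uniq ?se.
Qed.

Section Proper.
Variable Bs : seq (seq nat).
Hypothesis pB : proper Bs.

Let perm7 : perm_eq (flatten Bs) (iota 0 7). Proof. by case/and3P: pB. Qed.
Let uniq7 : uniq (flatten Bs). Proof. by rewrite (perm_uniq perm7) iota_uniq. Qed.

Lemma proper_mem B k : B \in Bs -> k \in B -> (k < 7)%N.
Proof.
move=> BB kB; have : k \in flatten Bs by apply/flattenP; exists B.
by rewrite (perm_mem perm7) mem_iota.
Qed.

Lemma proper_uniq B : B \in Bs -> uniq B.
Proof.
by move: uniq7 => + /(nthP [::])[i ib <-]; elim: (Bs) i ib => //= C Cs IH [|i] ib;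
  rewrite cat_uniq => /and3P[uC _ uCs] //; apply: IH.
Qed.

Lemma proper_eq B C k : B \in Bs -> C \in Bs -> k \in B -> k \in C -> B = C.
Proof.
move: uniq7; elim: (Bs) => //= D Ds IH; rewrite cat_uniq => /and3P[_ /hasPn dis uD].
have no E : E \in Ds -> k \in E -> k \notin D.
  by move=> EE kE; apply: dis; apply/flattenP; exists E.
rewrite !inE => /predU1P[->|BD] /predU1P[->|CD] // kB kC; last exact: IH.
  by have := no _ CD kC; rewrite kB.
by have := no _ BD kB; rewrite kC.
Qed.

Lemma block_inj : {in Bs &, injective block}.
Proof.
move=> B C BB CB /setP eq.
have : B != [::] by apply: contraTneq BB => ->; case/and3P: pB.
case: B BB eq => // k B BB eq _; have kB : k \in k :: B by rewrite mem_head.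
have [i ik] := index_onto (proper_mem BB kB).
by apply: (proper_eq BB CB kB); have := eq i; rewrite !inE ik eqxx => <-.
Qed.

Lemma set_partitionP B : reflect (exists2 C, C \in Bs & B = block C) (B \in set_partition Bs).
Proof. by rewrite inE; exact: mapP. Qed.

Lemma partition_set_partition : finset.partition (set_partition Bs) [set: I].
Proof.
apply/and3P; split.
- rewrite finset.eqEsubset finset.subsetT; apply/fintype.subsetP => i _; apply/finset.bigcupP.
  have : index i e \in flatten Bs by rewrite (perm_mem perm7) mem_iota index_lt7.
  move=> /flattenP[C CB iC]; exists (block C); last by rewrite inE.
  by apply/set_partitionP; exists C.
- apply/finset.trivIsetP => _ _ /set_partitionP[B BB ->] /set_partitionP[C CB ->] neq.
  apply/pred0P => i /=; apply/negP; rewrite !inE => /andP[iB iC].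
  by rewrite (proper_eq BB CB iB iC) eqxx in neq.
apply/negP => /set_partitionP[C CB] /esym/setP h.
have : C != [::] by apply: contraTneq CB => ->; case/and3P: pB.
case: C CB h => // k C CB h _.
have [i ik] := index_onto (proper_mem CB (mem_head k C)).
by have := h i; rewrite !inE ik eqxx.
Qed.

Lemma card_set_partition : #|set_partition Bs| = 3%N.
Proof.
have [/eqP s3 _ _] := and3P pB.
have uBs : uniq Bs.
  move: uniq7; have : [::] \notin Bs by case/and3P: pB.
  elim: (Bs) => //= C Cs IH; rewrite inE negb_or cat_uniq => /andP[C0 C0s] /and3P[_ dis /(IH C0s) ->].
  rewrite andbT; apply: contra dis => CC; case: C C0 CC => // k C _ CC; apply/hasP; exists k; rewrite ?mem_head //.
  by apply/flattenP; exists (k :: C); rewrite ?mem_head.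
rewrite -s3 -(size_map block); rewrite -(card_uniqP _); last by rewrite map_inj_in_uniq //; exact: block_inj.
by apply: eq_card => B; rewrite inE.
Qed.

Lemma separation_partition i j :
  has (fun B : seq nat => (index i e \in B) && (index j e \in B)) Bs =
  [exists B in set_partition Bs, (i \in B) && (j \in B)].
Proof.
apply/hasP/exists_inP => [[B BB /andP[iB jB]]|[_ /set_partitionP[B BB ->]]].
  by exists (block B); rewrite ?inE ?iB ?jB //; apply/mapP; exists B.
by rewrite !inE => h; exists B.
Qed.

Variables (R : realFieldType) (x : I -> R * R) (i0 : I).
Let pt k := x (nth i0 e k).

Lemma set_hull_block B z : B \in Bs -> in_hull pt B z -> set_hull x (block B) z.
Proof.
move=> BB [w [w0 w1 wx wy]].
have bigE (F : nat -> R) : \sum_(i in block B) F (index i e) = \sum_(k <- B) F k.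
  rewrite -big_enum -(big_map (fun i => index i e) xpredT); apply: perm_big; apply: uniq_perm.
  - by rewrite map_inj_uniq ?enum_uniq //; exact: index_inj.
  - exact: proper_uniq.
  move=> k; apply/mapP/idP => [[i + ->]|kB]; first by rewrite mem_enum inE.
  by have [i ik] := index_onto (proper_mem BB kB); exists i; rewrite // mem_enum inE ik.
exists (fun i => if index i e \in B then w (index i e) else 0); split.
- by move=> i; case: ifP => // /w0.
- rewrite -{}w1 -bigE; apply: eq_bigr => i; by rewrite inE => ->.
- rewrite -{}wx -bigE; apply: eq_bigr => i; rewrite inE => ->; by rewrite /pt nth_index.
- rewrite -{}wy -bigE; apply: eq_bigr => i; rewrite inE => ->; by rewrite /pt nth_index.
Qed.
End Proper.
End Labelling.

(** * Seven points in general position *)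

Lemma proper_splittings : all proper (stars ++ crossings).
Proof. by vm_compute. Qed.
Lemma uniq_separation : uniq (map separation (stars ++ crossings)).
Proof. by vm_compute. Qed.

Lemma separation_inj : {in stars ++ crossings &, injective separation}.
Proof.
move=> B C BS CS eq; rewrite -(nth_index B BS) -(nth_index B CS); congr nth; apply/eqP.
rewrite -(nth_uniq [::] _ _ uniq_separation) ?size_map ?index_mem //.
by rewrite !(nth_map B) ?index_mem // !nth_index // eq.
Qed.

Section Generic.
Local Open Scope ring_scope.
Variables (R : realFieldType) (I : finType) (x : I -> R * R).
Hypothesis cI : #|I| = 7%N.
Hypothesis distinct : forall i j, i != j -> (x i).1 != (x j).1.
Hypothesis general : forall i j k, uniq [:: i; j; k] -> orient (x i) (x j) (x k) != 0.

(** The leftmost point is a vertex of the hull, and the order by angle around it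
    is the order of slopes. *)
Lemma fan_order : exists i0 e, [/\ uniq e, size e = 7%N, forall i, i \in e &
  forall j k, (0 < j < k)%N -> (k < 7)%N -> 0 < orient (x (nth i0 e 0)) (x (nth i0 e j)) (x (nth i0 e k))].
Proof.
have /card_gt0P[j0 _] : (0 < #|I|)%N by rewrite cI.
case: (Order.TotalTheory.arg_minP (P := xpredT) (fun i => (x i).1) (i0 := j0) isT) => i0 _ min0.
have pos i : i != i0 -> 0 < (x i).1 - (x i0).1.
  by move=> ii0; rewrite subr_gt0 lt_neqAle eq_sym distinct // min0.
pose slope i := ((x i).2 - (x i0).2) / ((x i).1 - (x i0).1).
pose t := sort (fun i j => slope i <= slope j) [seq i <- enum I | i != i0].
have ut : uniq t by rewrite sort_uniq filter_uniq // enum_uniq.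
have mt i : (i \in t) = (i != i0) by rewrite mem_sort mem_filter mem_enum andbT.
have st : size t = 6%N.
  have := cardC (pred1 i0); rewrite card1 cI => -[] <-; rewrite -(card_uniqP ut).
  by apply: eq_card => i; rewrite mt.
exists i0, (i0 :: t); split => /=.
- by rewrite mt eqxx ut.
- by rewrite st.
- by move=> i; rewrite inE mt; case: eqP.
case=> // j [//|k] /= jk k7.
set a := nth i0 t j; set b := nth i0 t k.
have ai : a != i0 by rewrite -mt mem_nth // st; lia.
have bi : b != i0 by rewrite -mt mem_nth // st; lia.
have ab : a != b by rewrite nth_uniq ?st //; lia.
have sab : slope a <= slope b.
  apply: (sorted_leq_nth (leT := fun i j => slope i <= slope j)) => //.
  - by move=> ? ? ?; exact: le_trans.
  - by apply: sort_sorted => ? ?; exact: le_total.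
  - by rewrite inE st; lia.
  - by rewrite inE st; lia.
  - lia.
rewrite lt_neqAle eq_sym general ?(andbT, inE, negb_or) /=; last by rewrite !inE negb_or ![i0 == _]eq_sym ai bi ab.
have -> : orient (x i0) (x a) (x b) = ((x a).1 - (x i0).1) * ((x b).1 - (x i0).1) * (slope b - slope a).
  rewrite /orient /slope; field; by rewrite !gt_eqF ?pos.
by rewrite mulr_ge0 ?subr_ge0 // mulr_ge0 // ltW // pos.
Qed.

Lemma generic_four : exists Ps : seq {set {set I}}, [/\ uniq Ps, (4 <= size Ps)%N &
  forall P, P \in Ps -> [/\ finset.partition P [set: I], #|P| = 3%N & meeting x P]].
Proof.
have [i0 [e [ue se me fan]]] := fan_order.
have [|//|S [S4 sub meet]] := fan_four (pt := fun k => x (nth i0 e k)).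
  move=> a b c U /= /and4P[a7 b7 c7 _]; apply: general.
  move: U; rewrite /= !inE !negb_or => /and3P[/andP[ab ac] bc _].
  by rewrite !nth_uniq ?se // ab ac bc.
have prop B : B \in S -> proper B by move=> /(mem_subseq sub) /(allP proper_splittings).
exists (map (set_partition e) S); split.
- rewrite map_inj_in_uniq; first by apply: subseq_uniq sub _; apply: map_uniq uniq_separation.
  move=> B C BS CS eBC.
  apply: separation_inj; rewrite ?(mem_subseq sub) //.
  apply/eq_in_allpairs => j k; rewrite !mem_iota => /andP[_ /(index_onto ue se)[i <-]].
  move=> /andP[_ /(index_onto ue se)[i' <-]].
  by rewrite !(separation_partition e _ i i') eBC.
- by rewrite size_map.
move=> _ /mapP[B BS ->]; split.
- exact: partition_set_partition (prop _ BS).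
- exact: card_set_partition (prop _ BS).
have [z zB] := meet B BS; exists z => _ /set_partitionP[C CB ->].
by apply: (set_hull_block _ _ _ (prop _ BS) CB); [..|exact: zB].
Qed.
End Generic.

(** * Meeting hulls form a closed condition *)

Section Closed.
Local Open Scope ring_scope.

Lemma continuous_sum (R : realType) (T : topologicalType) (J : finType) (A : pred J) (F : J -> T -> R) :
  (forall j, A j -> continuous (F j)) -> continuous (fun v => \sum_(j | A j) F j v).
Proof. by move=> h; apply: continuous_big => //; exact: add_continuous. Qed.

Variables (R : realType) (I : finType) (x u : I -> R * R) (P : {set {set I}}).
Hypothesis part : finset.partition P [set: I]%SET.

Definition shift (t : R) (i : I) : R * R := ((x i).1 + t * (u i).1, (x i).2 + t * (u i).2).

(** The blocks are disjoint, so that one family of weights serves them all. *)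
Lemma meeting_weights (y : I -> R * R) : meeting y P ->
  exists w : I -> R, exists z : R * R, (forall i, 0 <= w i) /\
   forall B, B \in P -> [/\ \sum_(i in B) w i = 1,
     \sum_(i in B) w i * (y i).1 = z.1 & \sum_(i in B) w i * (y i).2 = z.2].
Proof.
move=> [z H].
have /choice[W HW] : forall B, exists w : I -> R, (forall i, 0 <= w i) /\ (B \in P -> [/\ \sum_(i in B) w i = 1,
     \sum_(i in B) w i * (y i).1 = z.1 & \sum_(i in B) w i * (y i).2 = z.2]).
  move=> B; case: (boolP (B \in P)) => [/H[w [? ? ? ?]]|_]; first by exists w.
  by exists (fun=> 0); split.
exists (fun i => W (finset.pblock P i) i), z; split=> [i|B BP]; first by have [] := HW (finset.pblock P i).
have [_ /(_ BP)[h1 h2 h3]] := HW B; have /and3P[_ tI _] := part.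
by split; rewrite -1?h1 -1?h2 -1?h3; apply: eq_bigr => i iB; rewrite (finset.def_pblock tI BP iB).
Qed.

(** A sum over a block with weights [v]; weights are row vectors because bounded
    closed boxes of row vectors are compact. *)
Definition coords (f : I -> R) (B : {set I}) (v : 'rV[R]_#|I|) : R :=
  \sum_(i in B) v ord0 (enum_rank i) * f i.

Lemma coords_continuous f B (v : 'rV[R]_#|I|) : {for v, continuous (coords f B)}.
Proof.
move: v; apply: continuous_sum => i _ v.
exact: cvgMr_tmp (@coord_continuous R 1 _ ord0 (enum_rank i) v).
Qed.

(** Among nonnegative weights, those with defect zero are the ones that make the
    blocks meet. *)
Definition defect (v : 'rV[R]_#|I|) : R :=
  \sum_(B in P) `|coords (fun=> 1) B v - 1| +
  \sum_(B in P) \sum_(C in P) (`|coords (fun i => (x i).1) B v - coords (fun i => (x i).1) C v|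
     + `|coords (fun i => (x i).2) B v - coords (fun i => (x i).2) C v|).

Lemma defect_continuous : continuous defect.
Proof.
have diff f B C : continuous (fun v => `|coords f B v - coords f C v|).
  by move=> v; exact: cvg_norm (cvgB (@coords_continuous f B v) (@coords_continuous f C v)).
have c1 : continuous (fun v => \sum_(B in P) `|coords (fun=> 1) B v - 1|).
  apply: continuous_sum => B _ v.
  exact: cvg_norm (cvgB (@coords_continuous (fun=> 1) B v) (cvg_cst (1 : R))).
have c2 : continuous (fun v => \sum_(B in P) \sum_(C in P)
    (`|coords (fun i => (x i).1) B v - coords (fun i => (x i).1) C v|
     + `|coords (fun i => (x i).2) B v - coords (fun i => (x i).2) C v|)).
  by do 2!apply: continuous_sum => ? _; move=> v; exact: cvgD (diff _ _ _ v) (diff _ _ _ v).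
move=> v; exact: cvgD (c1 v) (c2 v).
Qed.

(** Weights that work for the points moved by [t] have a defect of order [t] for
    the original points. The defect attains its minimum on the compact box of
    weights, and this minimum is therefore zero. *)
Lemma meeting_closed : (forall d, 0 < d -> exists2 t, 0 < t < d & meeting (shift t) P) -> meeting x P.
Proof.
move=> lim.
pose K : set 'rV[R]_#|I| := [set v | forall i, `[0, 1]%classic (v ord0 i)]%classic.
have cK : compact K by exact: (@rV_compact R _ (fun=> `[0, 1]%classic) (fun=> @segment_compact R 0 1)).
have K0 : (K !=set0)%classic by exists 0 => i /=; rewrite in_itv /= mxE lexx ler01.
have cf : ({within K, continuous defect})%classic by apply: continuous_subspaceT => v; exact: defect_continuous.
have [c cK' cmin] := EVT_min_rV K0 cK cf.
pose M (f : I -> R) : R := \sum_i `|f i|.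
pose C := \sum_(B in P) \sum_(D in P) ((M (fun i => (u i).1) *+ 2) + (M (fun i => (u i).2) *+ 2)).
have defect_ge0 v : 0 <= defect v.
  by apply: addr_ge0; apply: sumr_ge0 => B _ //; apply: sumr_ge0 => D _; apply: addr_ge0.
have small t : 0 < t -> meeting (shift t) P -> defect c <= t * C.
  move=> t0 /meeting_weights[w [z [w0 h]]].
  pose v : 'rV[R]_#|I| := \row_j w (enum_val j).
  have cv f B : coords f B v = \sum_(i in B) w i * f i.
    by apply: eq_bigr => i _; rewrite mxE enum_rankK.
  have w1 i : w i <= 1.
    have iP : finset.pblock P i \in P by rewrite finset.pblock_mem // (finset.cover_partition part) inE.
    have [<- _ _] := h _ iP; rewrite (bigD1 i) /= ?lerDl ?sumr_ge0 //.
    by rewrite finset.mem_pblock (finset.cover_partition part) inE.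
  have vK : v \in K by rewrite inE => i /=; rewrite in_itv /= mxE w0 w1.
  apply: le_trans (cmin v vK) _.
  have bound f B : `|\sum_(i in B) w i * f i| <= M f.
    apply: le_trans (ler_norm_sum _ _ _) _; rewrite /M big_mkcond /=; apply: ler_sum => i _.
    by case: ifP => // _; rewrite normrM (ger0_norm (w0 i)) ler_piMl.
  have diff f g s B D : (forall A, A \in P -> \sum_(i in A) w i * (f i + t * g i) = s) -> B \in P -> D \in P ->
      `|coords f B v - coords f D v| <= t * (M g *+ 2).
    move=> hs BP DP; rewrite !cv.
    have e A : A \in P -> \sum_(i in A) w i * f i = s - t * \sum_(i in A) w i * g i.
      move=> AP; rewrite -(hs A AP) mulr_sumr -sumrB; apply: eq_bigr => i _; ring.
    have -> : \sum_(i in B) w i * f i - \sum_(i in D) w i * f i =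
        t * (\sum_(i in D) w i * g i - \sum_(i in B) w i * g i) by rewrite !e //; ring.
    rewrite normrM (gtr0_norm t0) ler_pM2l //; apply: le_trans (ler_normB _ _) _.
    by rewrite mulr2n lerD.
  rewrite /defect /C big1 ?add0r; last first.
    move=> B BP; rewrite cv; have [h1 _ _] := h B BP.
    by under eq_bigr do rewrite mulr1; rewrite h1 subrr normr0.
  rewrite mulr_sumr; apply: ler_sum => B BP; rewrite mulr_sumr; apply: ler_sum => D DP.
  rewrite mulrDr; apply: lerD.
    by apply: (diff _ _ z.1) => // A AP; have [] := h A AP.
  by apply: (diff _ _ z.2) => // A AP; have [] := h A AP.
have C0 : 0 <= C by apply: sumr_ge0 => B _; apply: sumr_ge0 => D _; rewrite addr_ge0 // mulrn_wge0 // sumr_ge0.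
have dc0 : defect c = 0.
  apply/eqP; rewrite eq_le defect_ge0 andbT leNgt; apply/negP => pos.
  have [|t /andP[t0 td] /(small _ t0)] := lim (defect c / (C + 1)); first by rewrite divr_gt0 // ltr_wpDl.
  apply/negP; rewrite -ltNge; apply: le_lt_trans (_ : t * (C + 1) < _).
    by rewrite ler_pM2l // lerDl.
  by rewrite -ltr_pdivlMr // ltr_wpDl.
have S2 (F : {set I} -> {set I} -> R) : (forall B C, 0 <= F B C) ->
    \sum_(B in P) \sum_(D in P) F B D = 0 -> forall B D, B \in P -> D \in P -> F B D = 0.
  move=> F0 e B D BP DP.
  have e1 : \sum_(D in P) F B D = 0.
    by apply: (psumr_eq0P _ e) => // A _; apply: sumr_ge0 => ? _; exact: F0.
  by apply: (psumr_eq0P _ e1).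
have [s1 s2] : \sum_(B in P) `|coords (fun=> 1) B c - 1| = 0 /\
  \sum_(B in P) \sum_(C in P) (`|coords (fun i => (x i).1) B c - coords (fun i => (x i).1) C c|
     + `|coords (fun i => (x i).2) B c - coords (fun i => (x i).2) C c|) = 0.
  move/eqP: dc0; rewrite paddr_eq0; first by move=> /andP[/eqP ? /eqP ?].
    by apply: sumr_ge0.
  by apply: sumr_ge0 => B _; apply: sumr_ge0 => D _; apply: addr_ge0.
have [P0|[B0 B0P]] := set_0Vmem P; first by exists (0, 0) => B; rewrite P0 inE.
exists (coords (fun i => (x i).1) B0 c, coords (fun i => (x i).2) B0 c) => B BP.
exists (fun i => c ord0 (enum_rank i)); split.
- by move=> i; move: cK'; rewrite inE => /(_ (enum_rank i)); rewrite /= in_itv /= => /andP[].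
- have : `|coords (fun=> 1) B c - 1| = 0 by apply: (psumr_eq0P _ s1).
  move/eqP; rewrite normr_eq0 subr_eq0 => /eqP <-.
  by apply: eq_bigr => i _; rewrite mulr1.
all: have /eqP := S2 _ (fun B D => addr_ge0 (normr_ge0 _) (normr_ge0 _)) s2 _ _ BP B0P.
all: rewrite paddr_eq0 // !normr_eq0 !subr_eq0 => /andP[/eqP h1 /eqP h2].
- exact: h1.
- exact: h2.
Qed.
End Closed.

(** * Perturbation into general position *)

Section Perturbation.
Local Open Scope ring_scope.

Lemma small_nonroot (R : realFieldType) (p : {poly R}) (d : R) : p != 0 -> 0 < d -> exists2 t, 0 < t < d & ~~ root p t.
Proof.
move=> p0 d0; pose rs := mkseq (fun k => d / k.+2%:R) (size p).
have urs : uniq rs.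
  apply: mkseq_uniq => j k /(mulfI (lt0r_neq0 d0)) /invr_inj /eqP; rewrite eqr_nat => /eqP [] //.
have /allPn[t tin tr] : ~~ all (root p) rs.
  by apply/negP => /max_poly_roots => /(_ p0 urs); rewrite size_mkseq ltnn.
exists t => //; move/mapP: tin => [k _ ->]; rewrite divr_gt0 //=.
by rewrite ltr_pdivrMr // ltr_pMr // ltr1n.
Qed.

Variables (R : realType) (I : finType) (x : I -> R * R).
Let r (i : I) : R := (enum_rank i)%:R.
Definition moment_curve (i : I) : R * R := (r i, r i ^+ 2).
Notation y := (shift x moment_curve).

Lemma r_inj i j : i != j -> r i - r j != 0.
Proof. by rewrite subr_eq0 /r eqr_nat => /negP h; apply/negP => /eqP /ord_inj /enum_rank_inj /eqP. Qed.

(** The orientation of a triple of moved points is a polynomial in [t] of degree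
    two. Its leading coefficient is a Vandermonde determinant, hence not zero. *)
Lemma generic_shift d : 0 < d -> exists t, [/\ 0 < t < d,
  forall i j, i != j -> (y t i).1 != (y t j).1 &
  forall i j k, uniq [:: i; j; k] -> orient (y t i) (y t j) (y t k) != 0].
Proof.
move=> d0.
pose u := moment_curve.
pose L (ij : I * I) : {poly R} := ((x ij.1).1 - (x ij.2).1)%:P + (r ij.1 - r ij.2) *: 'X.
pose mixed i j k := ((x j).1 - (x i).1) * ((u k).2 - (u i).2) + ((u j).1 - (u i).1) * ((x k).2 - (x i).2)
  - ((x j).2 - (x i).2) * ((u k).1 - (u i).1) - ((u j).2 - (u i).2) * ((x k).1 - (x i).1).
pose Q (s : I * I * I) : {poly R} := let: (i, j, k) := s in
  (orient (x i) (x j) (x k))%:P + mixed i j k *: 'X + orient (u i) (u j) (u k) *: 'X^2.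
pose p := (\prod_(ij : I * I | ij.1 != ij.2) L ij) * \prod_(s : I * I * I | uniq [:: s.1.1; s.1.2; s.2]) Q s.
have p0 : p != 0.
  rewrite mulf_neq0 //; apply/prodf_neq0.
    move=> [i j] /= ij; apply/eqP => /(congr1 (fun q : {poly R} => q`_1)).
    rewrite coefD coefC coefZ coefX /= add0r mulr1 coef0; exact/eqP/r_inj.
  move=> [[i j] k] /= uq; apply/eqP => /(congr1 (fun q : {poly R} => q`_2)).
  rewrite !coefD coefC !coefZ coefX coefXn coef0 /= mulr0 mulr1 !add0r.
  have -> : orient (u i) (u j) (u k) = (r j - r i) * (r k - r i) * (r k - r j).
    by rewrite /orient /u /moment_curve /=; ring.
  move: uq; rewrite !inE negb_or => /and3P[/andP[ij ik] jk _].
  by apply/eqP; rewrite !mulf_neq0 // r_inj // eq_sym.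
have [t td tr] := small_nonroot p0 d0; exists t.
move: tr; rewrite rootM negb_or /root !horner_prod => /andP[/prodf_neq0 h1 /prodf_neq0 h2].
split=> // [i j ij|i j k uq].
  have := h1 (i, j) ij; rewrite !hornerE /shift /=; apply: contra; rewrite -subr_eq0 => /eqP h; apply/eqP.
  by rewrite -h; ring.
have := h2 (i, j, k) uq; rewrite !hornerE /shift /= => h; apply: contra h => /eqP h; apply/eqP.
by rewrite -h /mixed /orient /u /moment_curve /=; ring.
Qed.

(** A partition that does not meet at [x] does not meet at small shifts of [x]
    either, and a common bound works for all partitions. *)
Lemma four_meeting_partitions : #|I| = 7%N -> exists Ps : seq {set {set I}}, [/\ uniq Ps, (4 <= size Ps)%N &
  forall P, P \in Ps -> [/\ finset.partition P [set: I]%SET, #|P| = 3%N & meeting x P]].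
Proof.
move=> cI.
have /choice[delta del] : forall P : {set {set I}}, exists d : R, 0 < d /\
    (finset.partition P [set: I]%SET -> forall t, 0 < t < d -> meeting (y t) P -> meeting x P).
  move=> P; apply: contrapT => /forallNP no.
  have pP : finset.partition P [set: I]%SET.
    by apply: contrapT => nP; apply: (no 1); split => // /nP.
  have nm : ~ meeting x P by move=> m; apply: (no 1); split.
  apply: nm; apply: (meeting_closed (u := moment_curve)) => // d d0; apply: contrapT => h.
  by apply: (no d); split => // _ t td m; case: h; exists t.
pose d := \big[Num.min/1]_P delta P.
have d0 : 0 < d.
  by rewrite /d; elim/big_ind: _ => // [a b a0 b0|P _]; [rewrite lt_min a0|have [] := del P].
have [t [td dis gen]] := generic_shift d0.
have [Ps [uPs sPs hPs]] := generic_four cI dis gen.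
exists Ps; split=> // P /hPs[pP cP mP]; split => //.
have [_ /(_ pP t)] := del P; apply => //; move: td => /andP[-> /=] /lt_le_trans; apply.
exact: bigmin_le_cond.
Qed.
End Perturbation.

(** * Convex sets contain convex combinations *)

Section Hull.
Local Open Scope ring_scope.
Variables (R : realType) (n : nat) (C : set 'rV[R]_n).
Hypothesis cC : @convex_set R 'rV[R]_n C.

Lemma convex_pair a b (t : R) : C a -> C b -> 0 <= t <= 1 -> C (t *: a + (1 - t) *: b).
Proof.
move=> Ca Cb /andP[t0 t1]; have := cC (Itv01 t0 t1) (mem_set Ca) (mem_set Cb).
by rewrite inE.
Qed.

Lemma convex_comb (J : eqType) (s : seq J) (w : J -> R) (v : J -> 'rV[R]_n) :
  (forall i, 0 <= w i) -> (forall i, i \in s -> C (v i)) -> 0 < \sum_(i <- s) w i ->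
  C ((\sum_(i <- s) w i)^-1 *: \sum_(i <- s) w i *: v i).
Proof.
move=> w0; elim: s => [|i s IH] vC; rewrite ?big_nil ?ltxx // !big_cons.
have Ci : C (v i) by apply: vC; rewrite mem_head.
have Cs j : j \in s -> C (v j) by move=> js; apply: vC; rewrite inE js orbT.
set W := \sum_(j <- s) w j; have W0 : 0 <= W by apply: sumr_ge0.
move=> pos; have [We|Wn] := eqVneq W 0.
  have z : \sum_(j <- s) w j *: v j = 0.
    apply: big1_seq => j /andP[_ js]; suff -> : w j = 0 by rewrite scale0r.
    by move/eqP: We; rewrite psumr_eq0 // => /allP /(_ j js) /eqP.
  by rewrite We z !addr0 scalerA mulVf ?scale1r //; move: pos; rewrite We addr0 => /lt0r_neq0.
have Wp : 0 < W by rewrite lt_neqAle eq_sym Wn.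
have -> : (w i + W)^-1 *: (w i *: v i + \sum_(j <- s) w j *: v j) =
   (w i / (w i + W)) *: v i + (1 - w i / (w i + W)) *: (W^-1 *: \sum_(j <- s) w j *: v j).
  rewrite scalerDr !scalerA; congr (_ *: _ + _ *: _); first by rewrite mulrC.
  by field; rewrite Wn lt0r_neq0.
apply: convex_pair => //; first exact: IH.
by rewrite divr_ge0 ?(ltW pos) //= ler_pdivrMr // mul1r lerDl.
Qed.
End Hull.

Theorem theorem6 (R : realType) (X : {fset 'rV[R]_2}) (hX : #|` X| = 7) :
  ((3 - 1)`! ^ 2 <= #|tverberg_partitions 3 X|)%N.
Proof.
pose x (i : X) : (R * R)%type := (val i ord0 ord0, val i ord0 ord_max).
have cX : #|{: X}| = 7%N by rewrite -cardfE.
have [Ps [uPs sPs hPs]] := four_meeting_partitions x cX.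
apply: leq_trans sPs _; rewrite cardE; apply: uniq_leq_size => // P /hPs[pP cP [z zP]].
rewrite mem_enum inE; apply/asboolP; split => //.
exists (\row_j (if j == ord0 then z.1 else z.2))%R => B BP C [cC AC].
have [w [w0 w1 wx wy]] := zP B BP.
have vC i : i \in enum B -> C (val i) by rewrite mem_enum => iB; apply: AC; exists i.
have := convex_comb cC w0 vC; rewrite !big_enum /= w1 invr1 scale1r => /(_ ltr01).
congr C; apply/rowP => j; rewrite mxE summxE.
under eq_bigr do rewrite mxE.
case: eqP => [->|/eqP j0]; first by rewrite -wx.
rewrite -wy; suff -> : j = ord_max by [].
by apply/val_inj; case: j j0 => -[|[|]].
Qed.
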